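(* Let $\Gamma$ be a groupoid and let $\{R_j:j\in J\}$ and $\{T_j:j\in J'\}$ be summable families of gr-simple $\Gamma$-graded rings. Then $\prod^{gr}_{j\in J}R_j\cong_{gr}\prod^{gr}_{j\in J'}T_j$ if and only if there exists a bijection $\pi:J\to J'$ such that $R_j\cong_{gr}T_{\pi(j)}$ for each $j\in J$.
   Context: A groupoid $\Gamma$ is a small category with all morphisms invertible, identified with its set of morphisms; $\Gamma_0$ is its set of objects (identified with identity morphisms). For $\gamma:e\to f$ write $d(\gamma)=e$, $r(\gamma)=f$; $\delta\gamma$ is defined iff $d(\delta)=r(\gamma)$. A $\Gamma$-graded ring is an associative ring $R=\bigoplus_{\gamma\in\Gamma}R_\gamma$ (additive subgroups) with $R_\gamma R_\delta\subseteq R_{\gamma\delta}$ if $\gamma\delta$ is defined and $R_\gamma R_\delta=0$ otherwise, assumed object unital: for each $e\in\Gamma_0$, $R_e$ is a unital ring with identity $1_e$ (possibly $1_e=0$) and $1_{r(\gamma)}a=a=a1_{d(\gamma)}$ for $a\in R_\gamma$. $R$ need not be unital. $R$ is gr-simple if $R\neq0$ and its only graded two-sided ideals (those that are sums of their intersections with the $R_\gamma$) are $0$ and $R$. $\cong_{gr}$ means there is a degree-preserving ring isomorphism. $\prod^{gr}_{j}R_j$ is the $\Gamma$-graded ring with $\gamma$-component $\prod_j(R_j)_\gamma$; a family $\{R_j\}$ is summable if $\prod^{gr}_jR_j=\bigoplus_jR_j$, equivalently, for each $\gamma\in\Gamma$, $(R_j)_\gamma\neq0$ for only finitely many $j$.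 *)

(* Defs.v *)
From HB Require Import structures.
From mathcomp Require Import all_boot all_algebra.
From mathcomp Require Import boolp classical_sets functions cardinality fsbigop.

Set Implicit Arguments.
Unset Strict Implicit.
Unset Printing Implicit Defensive.

Import GRing.Theory.
Local Open Scope classical_set_scope.
Local Open Scope ring_scope.

(* A groupoid is given by its morphisms, with a total composition whose value
   [gcomp c b] (apply b first) is only constrained when [gdom c = gcod b].
   An object e is identified with the morphism [gid e]. The choiceType
   structure on morphisms is only there for [fsbigop]; under the axioms of
   [boolp] every type has one. *)
Record groupoid := Groupoid {
  gob : Type;
  gmor :> choiceType;
  gdom : gmor -> gob;
  gcod : gmor -> gob;
  gid : gob -> gmor;
  gcomp : gmor -> gmor -> gmor;
  ginv : gmor -> gmor;
  gdom_id : forall e, gdom (gid e) = e;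
  gcod_id : forall e, gcod (gid e) = e;
  gdom_comp : forall c b, gdom c = gcod b -> gdom (gcomp c b) = gdom b;
  gcod_comp : forall c b, gdom c = gcod b -> gcod (gcomp c b) = gcod c;
  gcompA : forall c b a, gdom c = gcod b -> gdom b = gcod a ->
    gcomp c (gcomp b a) = gcomp (gcomp c b) a;
  gcomp_idl : forall a, gcomp (gid (gcod a)) a = a;
  gcomp_idr : forall a, gcomp a (gid (gdom a)) = a;
  gdom_inv : forall a, gdom (ginv a) = gcod a;
  gcod_inv : forall a, gcod (ginv a) = gdom a;
  gcompVl : forall a, gcomp (ginv a) a = gid (gdom a);
  gcompVr : forall a, gcomp a (ginv a) = gid (gcod a)
}.

Section Subgroups.
Variable V : zmodType.

Definition is_subgroup (A : set V) :=
  A 0 /\ forall x y, A x -> A y -> A (x - y).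

Variables (I : choiceType) (A : I -> set V).

(* The finiteness condition is needed: [\sum_(i \in D) f i] is 0 by convention
   when f has infinite support. *)
Definition decomposes (f : I -> V) (x : V) :=
  [/\ forall i, A i (f i), finite_set [set i | f i != 0]
    & x = \sum_(i \in [set: I]) f i].

Definition sum_set : set V := [set x | exists f, decomposes f x].

(* V is the internal direct sum of the subgroups A i. *)
Definition is_direct_sum := forall x : V, exists! f, decomposes f x.

End Subgroups.

(* Rings are associative but need not have an identity, so mathcomp's ring
   structures do not apply; only the family of local identities is assumed. *)
Record graded_ring (G : groupoid) := GradedRing {
  gr_zmod :> zmodType;
  gr_mul : gr_zmod -> gr_zmod -> gr_zmod;
  gr_comp : G -> set gr_zmod;
  gr_one : gob G -> gr_zmod;
  gr_mulA : associative gr_mul;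
  gr_mulDl : left_distributive gr_mul +%R;
  gr_mulDr : right_distributive gr_mul +%R;
  gr_comp_subgroup : forall g, is_subgroup (gr_comp g);
  gr_direct : is_direct_sum gr_comp;
  gr_mul_comp : forall g h x y, gdom g = gcod h ->
    gr_comp g x -> gr_comp h y -> gr_comp (gcomp g h) (gr_mul x y);
  gr_mul_eq0 : forall g h x y, gdom g <> gcod h ->
    gr_comp g x -> gr_comp h y -> gr_mul x y = 0;
  gr_one_comp : forall e, gr_comp (gid e) (gr_one e);
  gr_mul1l : forall g x, gr_comp g x -> gr_mul (gr_one (gcod g)) x = x;
  gr_mul1r : forall g x, gr_comp g x -> gr_mul x (gr_one (gdom g)) = x
}.

Arguments gr_mul {G R} : rename.
Arguments gr_comp {G} R : rename.
Arguments gr_one {G} R : rename.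

Section GradedRings.
Variable G : groupoid.

Definition graded_ideal (R : graded_ring G) (I : set R) :=
  [/\ is_subgroup I,
      forall r x, I x -> I (gr_mul r x) /\ I (gr_mul x r)
    & I = sum_set (fun g => I `&` gr_comp R g)].

Definition gr_simple (R : graded_ring G) :=
  (exists x : R, x != 0) /\
  (forall I : set R, graded_ideal I -> I = [set 0] \/ I = [set: R]).

Definition gr_isomorphic (R S : graded_ring G) :=
  exists f : R -> S,
    [/\ bijective f, {morph f : x y / x + y}, {morph f : x y / gr_mul x y}
      & forall g x, gr_comp R g x -> gr_comp S g (f x)].

End GradedRings.

Section FullProduct.
Variables (J : Type) (V : J -> zmodType).

Definition fullprod : Type := forall j, V j.

HB.instance Definition _ := gen_eqMixin fullprod.
HB.instance Definition _ := gen_choiceMixin fullprod.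

Let zero : fullprod := fun=> 0.
Let opp (x : fullprod) : fullprod := fun j => - x j.
Let add (x y : fullprod) : fullprod := fun j => x j + y j.

Let addA : associative add.
Proof. by move=> x y z; apply: functional_extensionality_dep => j; exact: addrA. Qed.
Let addC : commutative add.
Proof. by move=> x y; apply: functional_extensionality_dep => j; exact: addrC. Qed.
Let add0 : left_id zero add.
Proof. by move=> x; apply: functional_extensionality_dep => j; exact: add0r. Qed.
Let addN : left_inverse zero opp add.
Proof. by move=> x; apply: functional_extensionality_dep => j; exact: addNr. Qed.

HB.instance Definition _ := GRing.isZmodule.Build fullprod addA addC add0 addN.

Lemma fullprodP (x y : fullprod) : (forall j, x j = y j) -> x = y.
Proof. exact: functional_extensionality_dep. Qed.

End FullProduct.

Section FiniteSums.
Variables (I : choiceType).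

Lemma fsum_seq (V : zmodType) (D : set I) (f : I -> V) :
    finite_set D -> (forall i, f i != 0 -> D i) ->
  \sum_(i \in [set: I]) f i = \sum_(i <- finmap.enum_fset (fset_set D)) f i.
Proof.
move=> Dfin fD; rewrite -fsbig_finite //=.
rewrite [RHS](fsbig_widen D [set: I]) //= => i [_ nDi] /=.
by apply/eqP; apply: contra_notT nDi; exact: fD.
Qed.

Lemma additive_fsum (V W : zmodType) (p : V -> W) (f : I -> V) :
    {morph p : x y / x + y} -> finite_set [set i | f i != 0] ->
  p (\sum_(i \in [set: I]) f i) = \sum_(i \in [set: I]) p (f i).
Proof.
move=> pD ffin.
have p0 : p 0 = 0 by apply: (addrI (p 0)); rewrite -pD !addr0.
rewrite !(@fsum_seq _ [set i | f i != 0]) //; last first.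
  by move=> i; apply: contraNneq => ->; rewrite p0.
exact: (big_morph p pD p0).
Qed.

Lemma finite_supp_additive (V W : zmodType) (p : V -> W) (f : I -> V) :
    {morph p : x y / x + y} -> finite_set [set i | f i != 0] ->
  finite_set [set i | p (f i) != 0].
Proof.
move=> pD; have p0 : p 0 = 0 by apply: (addrI (p 0)); rewrite -pD !addr0.
apply: sub_finite_set => i /=; apply: contraNneq => ->; by rewrite p0.
Qed.

Variables (V : zmodType) (A : I -> set V).
Hypothesis Asub : forall i, is_subgroup (A i).

Lemma sum_set_subgroup : is_subgroup (sum_set A).
Proof.
split.
  exists (fun=> 0); split=> [i||].
  - by case: (Asub i).
  - apply: (@sub_finite_set _ _ set0) => // i /=; by rewrite eqxx.
  - by rewrite (@fsum_seq _ set0) // ?big1 // => i; rewrite eqxx.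
move=> x y [f [fA ffin ->]] [h [hA hfin ->]].
exists (fun i => f i - h i); split=> [i||].
- by case: (Asub i) => _; apply.
- apply: (@sub_finite_set _ _ ([set i | f i != 0] `|` [set i | h i != 0])).
    move=> i /=; have [->|] := eqVneq (f i) 0; last by left.
    by rewrite sub0r oppr_eq0; right.
  by rewrite finite_setU.
- set D := [set i | f i != 0] `|` [set i | h i != 0].
  have Dfin : finite_set D by rewrite finite_setU.
  rewrite !(@fsum_seq _ D) //.
  + by rewrite sumrB.
  + move=> i /=; have [->|] := eqVneq (f i) 0; last by left.
    by rewrite sub0r oppr_eq0; right.
  + by right.
  + by left.
Qed.

Lemma sub_sum_set i : A i `<=` sum_set A.
Proof.
move=> x Ax; exists (fun k => if k == i then x else 0).
have supp k : (if k == i then x else 0) != 0 -> [set i] k.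
  by have [-> //|_] := eqVneq k i; rewrite eqxx.
split=> [k||].
- by have [->//|_] := eqVneq k i; case: (Asub k).
- exact: (sub_finite_set supp).
- by rewrite (fsum_seq (finite_set1 i) supp) fset_set1 finmap.big_seq_fset1 eqxx.
Qed.

End FiniteSums.

Section GradedProduct.
Variables (G : groupoid) (J : Type) (R : J -> graded_ring G).

Notation prodR := (fullprod (fun j => gr_zmod (R j))).

Definition prod_comp (g : G) : set prodR :=
  [set x | forall j, gr_comp (R j) g (x j)].

(* The carrier of the graded product: the sum, inside the full product of the
   R j, of the subgroups [prod_comp g]. *)
Definition gprod_set : set prodR := sum_set prod_comp.

Definition dsum_set : set prodR := [set x | finite_set [set j | x j != 0]].

Definition summable := gprod_set = dsum_set.

Lemma prod_comp_subgroup g : is_subgroup (prod_comp g).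
Proof.
split=> [j|x y xg yg j]; first by case: (gr_comp_subgroup (R j) g).
by case: (gr_comp_subgroup (R j) g) => _; apply.
Qed.

Definition gprod_pred : {pred prodR} := fun x => `[< gprod_set x >].

Let gprod_closed : zmod_closed gprod_pred.
Proof.
have [z s] := sum_set_subgroup prod_comp_subgroup.
split; first exact/asboolP.
by move=> x y /asboolP xP /asboolP yP; apply/asboolP/s.
Qed.

HB.instance Definition _ :=
  GRing.isZmodClosed.Build prodR gprod_pred gprod_closed.

Record gprod_type :=
  GProd { gprod_val : prodR; gprod_valP : gprod_val \in gprod_pred }.

HB.instance Definition _ := [isSub for gprod_val].
HB.instance Definition _ := [Choice of gprod_type by <:].
HB.instance Definition _ := [SubChoice_isSubZmodule of gprod_type by <:].

Definition prod_mul (x y : prodR) : prodR := fun j => gr_mul (x j) (y j).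

Lemma prod_mulDl : left_distributive prod_mul +%R.
Proof. by move=> x y z; apply: fullprodP => j; exact: gr_mulDl. Qed.

Lemma prod_mulDr : right_distributive prod_mul +%R.
Proof. by move=> x y z; apply: fullprodP => j; exact: gr_mulDr. Qed.

Lemma prod_mul0l y : prod_mul 0 y = 0.
Proof. by apply: (addrI (prod_mul 0 y)); rewrite -prod_mulDl !addr0. Qed.

Lemma prod_mul0r x : prod_mul x 0 = 0.
Proof. by apply: (addrI (prod_mul x 0)); rewrite -prod_mulDr !addr0. Qed.

Lemma prod_mul_gprod x y :
  x \in gprod_pred -> y \in gprod_pred -> prod_mul x y \in gprod_pred.
Proof.
move=> /asboolP[f [fA ffin ->]] /asboolP[h [hA hfin ->]].
have mDl z : {morph prod_mul^~ z : u v / u + v}.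
  by move=> u v; exact: prod_mulDl.
have mDr z : {morph prod_mul z : u v / u + v}.
  by move=> u v; exact: prod_mulDr.
rewrite (additive_fsum (mDl _)) // (@fsum_seq _ _ [set i | f i != 0]) //; last first.
  by move=> i /=; apply: contraNneq => ->; rewrite prod_mul0l.
apply: rpred_sum => a _.
rewrite (additive_fsum (mDr _)) // (@fsum_seq _ _ [set i | h i != 0]) //; last first.
  by move=> i /=; apply: contraNneq => ->; rewrite prod_mul0r.
apply: rpred_sum => b _.
have [ab|nab] := pselect (gdom a = gcod b).
  apply/asboolP/(sub_sum_set prod_comp_subgroup (i := gcomp a b)) => j.
  by apply: gr_mul_comp => //; [exact: fA|exact: hA].
rewrite (_ : prod_mul _ _ = 0) ?rpred0 //.
apply: fullprodP => j.
by apply: gr_mul_eq0 nab _ _; [exact: fA|exact: hA].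
Qed.

Definition gprod_mul (x y : gprod_type) : gprod_type :=
  GProd (prod_mul_gprod (gprod_valP x) (gprod_valP y)).

Definition gprod_comp (g : G) : set gprod_type :=
  [set x | prod_comp g (gprod_val x)].

Lemma prod_one_gprod (e : gob G) :
  ((fun j => gr_one (R j) e) : prodR) \in gprod_pred.
Proof.
apply/asboolP/(sub_sum_set prod_comp_subgroup (i := gid e)) => j.
exact: gr_one_comp.
Qed.

Definition gprod_one (e : gob G) : gprod_type := GProd (prod_one_gprod e).

Lemma gprod_eqP (x y : gprod_type) :
  (forall j, gprod_val x j = gprod_val y j) -> x = y.
Proof. by move=> xy; apply: val_inj; exact: fullprodP. Qed.

Let gmulA : associative gprod_mul.
Proof. by move=> x y z; apply: gprod_eqP => j; exact: gr_mulA. Qed.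

Let gmulDl : left_distributive gprod_mul +%R.
Proof. by move=> x y z; apply: gprod_eqP => j; exact: gr_mulDl. Qed.

Let gmulDr : right_distributive gprod_mul +%R.
Proof. by move=> x y z; apply: gprod_eqP => j; exact: gr_mulDr. Qed.

Let gcomp_sub g : is_subgroup (gprod_comp g).
Proof.
have [z s] := prod_comp_subgroup g.
by split=> [|x y xg yg]; [exact: z|exact: s].
Qed.

Let gdirect : is_direct_sum gprod_comp.
Proof.
move=> x.
have [f [fA ffin fx]] : gprod_set (gprod_val x).
  exact/asboolP/(gprod_valP x).
pose F g : gprod_type :=
  GProd (introT (asboolP _) (sub_sum_set prod_comp_subgroup (fA g))).
have valD : {morph gprod_val : u v / u + v} by [].
have Ffin : finite_set [set g | F g != 0].
  by apply: sub_finite_set ffin => g /=; apply: contraNneq => fg0; apply/eqP/val_inj.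
have xE : x = \sum_(g \in [set: G]) F g.
  by apply: val_inj => /=; rewrite (additive_fsum valD Ffin).
exists F; split; first by [].
move=> H [HA Hfin Hx].
apply: funext => g; apply: gprod_eqP => j.
have pD : {morph (fun u : gprod_type => gprod_val u j) : u v / u + v} by [].
have [k [_ kU]] := gr_direct (gprod_val x j).
have decF : decomposes (gr_comp (R j)) (fun g => gprod_val (F g) j) (gprod_val x j).
  split=> [i||]; first exact: fA.
    exact: (finite_supp_additive pD).
  by rewrite -(additive_fsum pD) // -xE.
have decH : decomposes (gr_comp (R j)) (fun g => gprod_val (H g) j) (gprod_val x j).
  split=> [i||]; first exact: HA.
    exact: (finite_supp_additive pD).
  by rewrite -(additive_fsum pD) // -Hx.
by have := kU _ decF; rewrite (kU _ decH) => /(congr1 (fun u => u g)).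
Qed.

Let gmul_comp g h x y : gdom g = gcod h ->
  gprod_comp g x -> gprod_comp h y -> gprod_comp (gcomp g h) (gprod_mul x y).
Proof. by move=> gh xg yh j; apply: gr_mul_comp. Qed.

Let gmul_eq0 g h x y : gdom g <> gcod h ->
  gprod_comp g x -> gprod_comp h y -> gprod_mul x y = 0.
Proof. by move=> gh xg yh; apply: gprod_eqP => j; exact: gr_mul_eq0 gh _ _. Qed.

Let gone_comp e : gprod_comp (gid e) (gprod_one e).
Proof. by move=> j; exact: gr_one_comp. Qed.

Let gmul1l g x : gprod_comp g x -> gprod_mul (gprod_one (gcod g)) x = x.
Proof. by move=> xg; apply: gprod_eqP => j; exact: gr_mul1l. Qed.

Let gmul1r g x : gprod_comp g x -> gprod_mul x (gprod_one (gdom g)) = x.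
Proof. by move=> xg; apply: gprod_eqP => j; exact: gr_mul1r. Qed.

Definition gprod : graded_ring G :=
  GradedRing gmulA gmulDl gmulDr gcomp_sub gdirect gmul_comp gmul_eq0
    gone_comp gmul1l gmul1r.

Lemma summableP :
  summable <-> forall g,
    finite_set [set j | exists x : R j, gr_comp (R j) g x /\ x != 0].
Proof.
split=> [E g|Rfin].
  pose y : prodR := fun j =>
    if pselect (exists x : R j, gr_comp (R j) g x /\ x != 0) is left P
    then projT1 (cid P) else 0.
  have yg : prod_comp g y.
    move=> j; rewrite /y; case: pselect => [P|_]; last by case: (gr_comp_subgroup (R j) g).
    by case: cid => ? [].
  have : dsum_set y by rewrite -E; exact: (sub_sum_set prod_comp_subgroup yg).
  apply: sub_finite_set => j /= P; rewrite /y; case: pselect => // Q.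
  by case: cid => ? [].
apply/seteqP; split=> x.
  move=> [f [fA ffin fx]].
  have : finite_set (\bigcup_(g in [set g | f g != 0])
      [set j | exists x : R j, gr_comp (R j) g x /\ x != 0]).
    by apply: bigcup_finite => // g _; exact: Rfin.
  apply: sub_finite_set => j /=; rewrite fx => xj.
  have pD : {morph (fun u : prodR => u j) : u v / u + v} by [].
  apply: contrapT => H; move/negP: xj; apply; apply/eqP.
  rewrite (additive_fsum pD ffin) (@fsum_seq _ _ [set i | f i != 0]) //; last first.
    by move=> i /=; apply: contraNneq => ->.
  apply: big1 => g _; apply/eqP; apply: contrapT => fgj.
  apply: H; exists g => /=; last first.
    by exists (f g j); split; [exact: fA|exact/negP].
  by apply/negP => /eqP f0; apply: fgj; rewrite f0.
move=> xfin.
pose f j := projT1 (cid (gr_direct (x j))).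
have fP j : unique (fun f => decomposes (gr_comp (R j)) f (x j)) (f j).
  by rewrite /f; case: cid.
pose F g : prodR := fun j => f j g.
have Ffin : finite_set [set g | F g != 0].
  have : finite_set (\bigcup_(j in [set j | x j != 0]) [set g | f j g != 0]).
    by apply: bigcup_finite => // j _; case: (fP j) => -[].
  apply: sub_finite_set => g /= Fg; apply: contrapT => H.
  move/negP: Fg; apply; apply/eqP/fullprodP => j.
  have [[fA ffin fx] fU] := fP j.
  have [xj0|xj] := eqVneq (x j) 0; last first.
    apply/eqP; apply: contrapT => fgj; apply: H; exists j => //=; exact/negP.
  suff -> : F g j = (fun=> 0) g by [].
  rewrite /F; congr (_ g); apply: fU; split=> [i||].
  - by case: (gr_comp_subgroup (R j) i).
  - by apply: (@sub_finite_set _ _ set0) => // i /=; rewrite eqxx.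
  - by rewrite (@fsum_seq _ _ set0) // ?big1 // => i; rewrite eqxx.
exists F; split=> // [g j|]; first by case: (fP j) => -[].
apply: fullprodP => j.
have pD : {morph (fun u : prodR => u j) : u v / u + v} by [].
by rewrite (additive_fsum pD Ffin); case: (fP j) => -[].
Qed.

End GradedProduct.

(* Main.v *)
Require Import Defs.
From mathcomp Require Import all_boot all_algebra.
From mathcomp Require Import boolp classical_sets cardinality fsbigop.

(** A bijection of index sets with isomorphic factors gives an isomorphism of
    the products coordinate by coordinate ([gprod_isomorphic]); all the work is
    in the other direction.

    Let F be a graded isomorphism from the product of the R j to the product of
    the T k.  Its corner at (j, k) is the composite R j -> T k of the inclusion
    of the j-th factor, F, and the k-th projection.  The kernel of a corner is
    a graded ideal of R j, and its range is a graded ideal of T k because the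
    inclusion of R j is an ideal of the first product and F and the projection
    are surjective.  As both factors are gr-simple, a nonzero corner is an
    isomorphism ([matched_isomorphic]).

    It remains to see that the nonzero corners are the graph of a bijection.
    Call j and k matched when F sends some nonzero element of the factor R j
    into the factor T k: unlike the nonvanishing of a corner, this condition is
    visibly symmetric under exchanging F and its inverse ([matched_sym]), so it
    suffices to show that every j is matched with exactly one k.
    - Existence ([matched_total]): take r homogeneous and nonzero in R j.  Some
      coordinate t of F r is nonzero, and multiplying F r on the right by the
      local identity of that coordinate which fixes t cuts F r down to t.  The
      result is again the image of an element of R j, since R j is an ideal.
    - Uniqueness ([matched_functional]): if j is matched with k through r and
      also with k' different from k, the corner at (j, k') is nonzero, hence
      injective, but it kills r. *)

Set Implicit Arguments.
Unset Strict Implicit.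
Unset Printing Implicit Defensive.

Import GRing.Theory.
Local Open Scope classical_set_scope.
Local Open Scope ring_scope.

(** * Homogeneous decompositions *)

Lemma additive_map0 (V W : zmodType) (p : V -> W) :
  {morph p : x y / x + y} -> p 0 = 0.
Proof. by move=> pD; apply: (addrI (p 0)); rewrite -pD !addr0. Qed.

Lemma additive_mapN (V W : zmodType) (p : V -> W) :
  {morph p : x y / x + y} -> {morph p : x / - x}.
Proof.
move=> pD x; apply: (addrI (p x)).
by rewrite -pD !subrr (additive_map0 pD).
Qed.

Lemma decomposes_additive (I : choiceType) (V W : zmodType)
    (A : I -> set V) (B : I -> set W) (p : V -> W) f x :
    {morph p : x y / x + y} -> (forall i y, A i y -> B i (p y)) ->
  decomposes A f x -> decomposes B (p \o f) (p x).
Proof.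
move=> pD pAB [fA ffin ->]; split=> [i||].
- exact/pAB/fA.
- exact: (finite_supp_additive pD).
- exact: additive_fsum.
Qed.

Lemma decomposes_single (I : choiceType) (V : zmodType) (A : I -> set V) i x :
    (forall k, is_subgroup (A k)) -> A i x ->
  decomposes A (fun k => if k == i then x else 0) x.
Proof.
move=> Asub Ax.
have supp k : (if k == i then x else 0) != 0 -> [set i] k.
  by have [-> //|_] := eqVneq k i; rewrite eqxx.
split=> [k||].
- by have [->//|_] := eqVneq k i; case: (Asub k).
- exact: (sub_finite_set supp).
- by rewrite (fsum_seq (finite_set1 i) supp) fset_set1 finmap.big_seq_fset1 eqxx.
Qed.

Lemma decomposes_inj (I : choiceType) (V : zmodType) (A : I -> set V) f h x :
  is_direct_sum A -> decomposes A f x -> decomposes A h x -> f = h.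
Proof. by move=> dA fx hx; have [u [_ uU]] := dA x; rewrite -(uU f) // (uU h). Qed.

Lemma sum_set_sub_subgroup (I : choiceType) (V : zmodType)
    (A : I -> set V) (B : set V) :
  is_subgroup B -> (forall i, A i `<=` B) -> sum_set A `<=` B.
Proof.
move=> [B0 BB] AB x [f [fA ffin ->]].
rewrite (@fsum_seq _ _ [set i | f i != 0]) //.
apply: (big_ind B) => // [u v Bu Bv|i _]; last exact/AB/fA.
by rewrite -[v]opprK -(sub0r v); apply: (BB) => //; apply: BB.
Qed.

(** * Graded rings, graded ideals and graded homomorphisms *)

Section GradedRingTheory.
Variable G : groupoid.
Implicit Types R S : graded_ring G.

Lemma gr_mul0r R (x : R) : gr_mul 0 x = 0.
Proof. exact: (@additive_map0 _ _ (gr_mul^~ x) (fun u v => gr_mulDl u v x)). Qed.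

Lemma gr_mulr0 R (x : R) : gr_mul x 0 = 0.
Proof. exact: (@additive_map0 _ _ (gr_mul x) (fun u v => gr_mulDr x u v)). Qed.

Lemma homogeneous_neq0 R :
  (exists x : R, x != 0) -> exists g (x : R), gr_comp R g x /\ x != 0.
Proof.
move=> [x /negP x0]; apply: contrapT => nh; apply: x0; apply/eqP.
have [f [[fA ffin ->] _]] := gr_direct x.
rewrite (@fsum_seq _ _ [set i | f i != 0]) // big1 // => i _.
by apply/eqP/negPn/negP => fi0; apply: nh; exists i, (f i).
Qed.

(** A subgroup closed under taking homogeneous components is the sum of its
    homogeneous parts; this form spares the construction of decompositions
    whenever gradedness has to be checked. *)
Lemma graded_ideal_components R (I : set R) :
    is_subgroup I ->
    (forall r x, I x -> I (gr_mul r x) /\ I (gr_mul x r)) ->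
    (forall x f, I x -> decomposes (gr_comp R) f x -> forall g, I (f g)) ->
  graded_ideal I.
Proof.
move=> Isub Imul Icomp; split=> //; apply/seteqP; split; last first.
  by apply: sum_set_sub_subgroup => // g x [].
move=> x Ix; have [f [fx _]] := gr_direct x.
exists f; case: (fx) => fA ffin xE; split=> // g.
by split=> //; apply: Icomp fx g.
Qed.

Definition graded_hom R S (f : R -> S) :=
  [/\ {morph f : x y / x + y}, {morph f : x y / gr_mul x y}
    & forall g x, gr_comp R g x -> gr_comp S g (f x)].

Lemma graded_hom_comp R S (U : graded_ring G) (f : R -> S) (h : S -> U) :
  graded_hom f -> graded_hom h -> graded_hom (h \o f).
Proof.
move=> [fD fM fg] [hD hM hg]; split=> [x y|x y|g x xg] /=.
- by rewrite fD hD.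
- by rewrite fM hM.
- exact/hg/fg.
Qed.

(** A bijective graded homomorphism reflects degrees: the image under f of the
    homogeneous decomposition of h y is a decomposition of y, so when y is
    homogeneous uniqueness leaves only one component of h y. *)
Lemma graded_hom_inverse R S (f : R -> S) (h : S -> R) :
  cancel f h -> cancel h f -> graded_hom f -> graded_hom h.
Proof.
move=> fK hK [fD fM fg]; split=> [x y|x y|g y yg].
- by rewrite -[in LHS](hK x) -[in LHS](hK y) -fD fK.
- by rewrite -[in LHS](hK x) -[in LHS](hK y) -fM fK.
have [u [ux _]] := gr_direct (h y).
have := decomposes_additive fD fg ux; rewrite hK => fux.
have := decomposes_single (gr_comp_subgroup S) yg.
move=> /(decomposes_inj (@gr_direct _ S) fux)/(congr1 (fun v => v g)) /=.
by rewrite eqxx => <-; rewrite fK; case: ux.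
Qed.

Lemma graded_hom_bijective R S (f : R -> S) :
  graded_hom f -> injective f -> (forall y, exists x, f x = y) ->
  gr_isomorphic R S.
Proof.
move=> [fD fM fg] fI /choice[h hK]; exists f; split=> //.
by exists h => // x; apply: fI.
Qed.

Lemma gr_isomorphicP R S : gr_isomorphic R S <->
  exists (f : R -> S) (h : S -> R),
    [/\ cancel f h, cancel h f, graded_hom f & graded_hom h].
Proof.
split=> [[f [[h fK hK] fD fM fg]]|[f [h [fK hK [fD fM fg] _]]]].
  by exists f, h; split=> //; apply: (graded_hom_inverse fK hK).
by exists f; split=> //; exists h.
Qed.

Lemma graded_ker_ideal R S (f : R -> S) :
  graded_hom f -> graded_ideal [set x | f x = 0].
Proof.
move=> [fD fM fg]; apply: graded_ideal_components.
- split=> /= [|x y x0 y0]; first exact: additive_map0.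
  by rewrite fD (additive_mapN fD) x0 y0 subrr.
- by move=> r x /= x0; rewrite !fM x0 gr_mul0r gr_mulr0.
move=> x u /= x0 ux g.
have := decomposes_additive fD fg ux; rewrite x0 => fux.
have zS : gr_comp S g 0 by case: (gr_comp_subgroup S g).
have := decomposes_single (gr_comp_subgroup S) zS.
by move=> /(decomposes_inj (@gr_direct _ S) fux)/(congr1 (fun v => v g)) /=; rewrite eqxx.
Qed.

Lemma graded_hom_simple_inj R S (f : R -> S) :
  gr_simple R -> graded_hom f -> (exists x, f x != 0) -> injective f.
Proof.
move=> [_ Rs] fh [x fx0]; case: (fh) => fD _ _.
have [kE|kE] := Rs _ (graded_ker_ideal fh); last first.
  have : [set: R] x by [].
  by rewrite -kE /= => /eqP; rewrite (negbTE fx0).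
move=> y z fyz; apply/eqP; rewrite -subr_eq0; apply/eqP.
have : [set x | f x = 0] (y - z) by rewrite /= fD (additive_mapN fD) fyz subrr.
by rewrite kE.
Qed.

(** The hypothesis on products says that the range of f is an ideal, which is
    not automatic for a homomorphism that does not preserve identities. *)
Lemma graded_hom_simple_surj R S (f : R -> S) :
    gr_simple S -> graded_hom f -> (exists x, f x != 0) ->
    (forall s x, exists y z, gr_mul s (f x) = f y /\ gr_mul (f x) s = f z) ->
  forall s, exists x, f x = s.
Proof.
move=> [_ Ss] fh [x fx0] fabs; case: (fh) => fD _ fg.
have fI : graded_ideal (range f).
  apply: graded_ideal_components.
  - split; first by exists 0 => //; exact: additive_map0.
    move=> _ _ [a _ <-] [b _ <-]; exists (a - b) => //.
    by rewrite fD (additive_mapN fD).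
  - by move=> s _ [a _ <-]; have [y [z [-> ->]]] := fabs s a.
  move=> _ u [a _ <-] ua g; have [v [va _]] := gr_direct a.
  rewrite (decomposes_inj (@gr_direct _ S) ua (decomposes_additive fD fg va)).
  by exists (v g).
move=> s; have [iE|iE] := Ss _ fI.
  have : range f (f x) by exists x.
  by rewrite iE /= => /eqP; rewrite (negbTE fx0).
have : [set: S] s by [].
by rewrite -iE => -[a _ <-]; exists a.
Qed.

End GradedRingTheory.

(** * Coordinates of a graded product *)

Section ProductCoordinates.
Variables (G : groupoid) (J : Type) (R : J -> graded_ring G).

Definition proj (k : J) (x : gprod R) : R k := gprod_val x k.

Lemma proj_hom k : graded_hom (proj k).
Proof. by split=> // g x; apply. Qed.

(** The vector with r at index j and 0 elsewhere; as the factors live in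
    different types, r has to be transported along the equality of indices. *)
Definition single (j : J) (r : R j) : fullprod (fun j => gr_zmod (R j)) :=
  fun k => if pselect (j = k) is left e then eq_rect j R r k e else 0.

Lemma single_diag j (r : R j) : single r j = r.
Proof.
rewrite /single; case: pselect => // e.
by rewrite (Prop_irrelevance e erefl).
Qed.

Lemma single_off j (r : R j) k : j <> k -> single r k = 0.
Proof. by rewrite /single; case: pselect. Qed.

Lemma single_gprod j (r : R j) : single r \in gprod_pred (R := R).
Proof.
have sD : {morph @single j : x y / x + y}.
  move=> x y; apply: fullprodP => k.
  rewrite -[RHS]/(single x k + single y k).
  have [<-|jk] := pselect (j = k); first by rewrite !single_diag.
  by rewrite !single_off // addr0.
have sg g x : gr_comp (R j) g x -> prod_comp (R := R) g (single x).
  move=> xg k; have [<-|jk] := pselect (j = k); first by rewrite single_diag.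
  by rewrite single_off //; case: (gr_comp_subgroup (R k) g).
have [f [fr _]] := gr_direct r.
by apply/asboolP; eexists; exact: (decomposes_additive sD sg fr).
Qed.

Definition inj j (r : R j) : gprod R := GProd (single_gprod r).

Lemma projK j (r : R j) : proj j (inj r) = r. Proof. exact: single_diag. Qed.

Lemma proj_inj_off j (r : R j) k : j <> k -> proj k (inj r) = 0.
Proof. exact: single_off. Qed.

Lemma gprod_eq (x y : gprod R) : (forall k, proj k x = proj k y) -> x = y.
Proof. exact: gprod_eqP. Qed.

Lemma gprod_neq0 (x : gprod R) : x != 0 -> exists k, proj k x != 0.
Proof.
move=> /negP x0; apply: contrapT => nk; apply: x0; apply/eqP/gprod_eq => k.
apply/eqP/negPn/negP => xk; apply: nk; by exists k.
Qed.

(** The sums and products below are recognized as values of [inj] through this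
    characterization by coordinates, which avoids the transport in [single]. *)
Lemma eq_inj j (r : R j) (x : gprod R) :
  proj j x = r -> (forall k, j <> k -> proj k x = 0) -> x = inj r.
Proof.
move=> xj x0; apply: gprod_eq => k.
have [<-|jk] := pselect (j = k); first by rewrite projK.
by rewrite x0 // proj_inj_off.
Qed.

(** Together with [mulr_inj]: the j-th factor is a two-sided ideal of the
    product. *)
Lemma inj_mulr j (r : R j) (x : gprod R) :
  gr_mul (inj r) x = inj (gr_mul r (proj j x)).
Proof.
have [_ pM _] := proj_hom j.
apply: eq_inj => [|k jk]; first by rewrite pM projK.
by have [_ -> _] := proj_hom k; rewrite proj_inj_off // gr_mul0r.
Qed.

Lemma mulr_inj j (r : R j) (x : gprod R) :
  gr_mul x (inj r) = inj (gr_mul (proj j x) r).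
Proof.
have [_ pM _] := proj_hom j.
apply: eq_inj => [|k jk]; first by rewrite pM projK.
by have [_ -> _] := proj_hom k; rewrite proj_inj_off // gr_mulr0.
Qed.

Lemma inj_hom j : graded_hom (@inj j).
Proof.
split=> [x y|x y|g x xg].
- symmetry; apply: eq_inj => [|k jk]; have [pD _ _] := proj_hom j.
    by rewrite pD !projK.
  by have [-> _ _] := proj_hom k; rewrite !proj_inj_off // addr0.
- by rewrite inj_mulr projK.
suff ig k : gr_comp (R k) g (proj k (inj x)) by move=> k; exact: ig.
have [<-|jk] := pselect (j = k); first by rewrite projK.
by rewrite proj_inj_off //; case: (gr_comp_subgroup (R k) g).
Qed.

Lemma inj_eq0 j (r : R j) : (inj r == 0) = (r == 0).
Proof.
have [iD _ _] := inj_hom j; have [pD _ _] := proj_hom j.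
apply/eqP/eqP => [r0|->]; last exact: additive_map0.
by rewrite -(projK r) r0 (additive_map0 pD).
Qed.

End ProductCoordinates.

(** * Isomorphisms of graded products match simple factors *)

Section Matching.
Variables (G : groupoid) (J J' : Type).
Variables (R : J -> graded_ring G) (T : J' -> graded_ring G).

Definition matched (F : gprod R -> gprod T) j k :=
  exists (r : R j) (t : T k), r != 0 /\ F (inj r) = inj t.

Definition corner (F : gprod R -> gprod T) j k (r : R j) : T k :=
  proj k (F (inj r)).

Lemma corner_hom (F : gprod R -> gprod T) j k :
  graded_hom F -> graded_hom (@corner F j k).
Proof.
move=> Fh.
exact: (graded_hom_comp (graded_hom_comp (inj_hom R j) Fh) (proj_hom T k)).
Qed.

Variables (F : gprod R -> gprod T) (F' : gprod T -> gprod R).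
Hypotheses (FK : cancel F F') (F'K : cancel F' F) (Fh : graded_hom F).

(** Being matched is formally stronger than having a nonzero corner: the image
    of r has no coordinate besides the one in T k. *)
Lemma matched_corner_neq0 j k : matched F j k -> exists r, corner F k (j := j) r != 0.
Proof.
move=> [r [t [r0 rt]]]; exists r; rewrite /corner rt projK.
have [FD _ _] := Fh.
rewrite -inj_eq0 -rt -(additive_map0 FD) (inj_eq (can_inj FK)).
by rewrite inj_eq0.
Qed.

(** Multiplying by a local identity of T k isolates one coordinate of F r
    without leaving the image of R j. *)
Lemma matched_total j : gr_simple (R j) -> exists k, matched F j k.
Proof.
move=> [/homogeneous_neq0[g [r [rg r0]]] _].
have [FD FM Fg] := Fh; have [_ _ ig] := inj_hom R j.
have /gprod_neq0[k Frk] : F (inj r) != 0.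
  by rewrite -(additive_map0 FD) (inj_eq (can_inj FK)) inj_eq0.
exists k; pose t := corner F k r.
have tg : gr_comp (T k) g t by have [_ _ ] := corner_hom j k Fh; apply.
(* [gdom g] is the object whose identity fixes t on the right. *)
pose z := inj (gr_one (T k) (gdom g)).
have E : F (inj (gr_mul r (proj j (F' z)))) = inj t.
  by rewrite -inj_mulr FM F'K mulr_inj (gr_mul1r tg).
exists (gr_mul r (proj j (F' z))), t; split=> //.
by rewrite -inj_eq0 -(inj_eq (can_inj FK)) E (additive_map0 FD) inj_eq0.
Qed.

(** A second match of j would give an injective corner that vanishes on the
    element r witnessing the first one. *)
Lemma matched_functional j k k' :
  gr_simple (R j) -> matched F j k -> matched F j k' -> k = k'.
Proof.
move=> Rs [r [t [r0 rt]]] /matched_corner_neq0.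
have ch := corner_hom j k' Fh; have [cD _ _] := ch.
move=> /(graded_hom_simple_inj Rs ch) cI.
apply: contrapT => kk'; move/eqP: r0; apply; apply: cI.
by rewrite (additive_map0 cD) /corner rt proj_inj_off.
Qed.

(** The range of the corner absorbs a product with t in T k because t is the
    k-th coordinate of F (F' t), and multiplying r by F' t stays in R j. *)
Lemma matched_isomorphic j k :
  gr_simple (R j) -> gr_simple (T k) -> matched F j k ->
  gr_isomorphic (R j) (T k).
Proof.
move=> Rs Ts /matched_corner_neq0 c0.
have ch := corner_hom j k Fh; have [_ FM _] := Fh.
have [_ pM _] := proj_hom T k.
have cI := graded_hom_simple_inj Rs ch c0.
have cS : forall t, exists r, corner F k (j := j) r = t.
  apply: graded_hom_simple_surj => // t r.
  exists (gr_mul (proj j (F' (inj t))) r), (gr_mul r (proj j (F' (inj t)))).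
  by rewrite /corner -inj_mulr -mulr_inj !FM F'K !pM projK.
exact: graded_hom_bijective ch cI cS.
Qed.

End Matching.

Lemma matched_sym (G : groupoid) (J J' : Type)
    (R : J -> graded_ring G) (T : J' -> graded_ring G)
    (F : gprod R -> gprod T) (F' : gprod T -> gprod R) j k :
    cancel F F' -> {morph F : x y / x + y} ->
  matched F j k -> matched F' k j.
Proof.
move=> FK FD [r [t [r0 rt]]]; exists t, r; split; last by rewrite -rt FK.
by rewrite -inj_eq0 -rt -(additive_map0 FD) (inj_eq (can_inj FK)) inj_eq0.
Qed.

(** * Reindexing a graded product *)

(** Stated by existence so that the transport between [V (pi (s k))] and [V k]
    stays inside the proof. *)
Lemma reindex_family (J J' : Type) (V : J' -> Type) (pi : J -> J') :
  bijective pi -> forall z : forall j, V (pi j),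
  exists y : forall k, V k, forall j, y (pi j) = z j.
Proof.
move=> [s piK sK] z; exists (fun k => eq_rect _ V (z (s k)) k (sK k)) => j.
move: (sK (pi j)); rewrite (piK j) => e.
by rewrite (Prop_irrelevance e erefl).
Qed.

Lemma gprod_pred_additive (G : groupoid) (J J' : Type)
    (R : J -> graded_ring G) (T : J' -> graded_ring G)
    (p : fullprod (fun j => gr_zmod (R j)) -> fullprod (fun k => gr_zmod (T k))) :
    {morph p : x y / x + y} ->
    (forall g x, prod_comp (R := R) g x -> prod_comp (R := T) g (p x)) ->
  forall x, x \in gprod_pred (R := R) -> p x \in gprod_pred (R := T).
Proof.
move=> pD pg x /asboolP[f fx].
by apply/asboolP; eexists; exact: (decomposes_additive pD pg fx).
Qed.

(** Both coordinatewise maps are built on the full products, where the one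
    going against [pi] is a plain composition and the other one is determined
    by its values at the indices [pi j]; being additive and preserving
    homogeneous vectors, they restrict to the graded products. *)
Lemma gprod_isomorphic (G : groupoid) (J J' : Type)
    (R : J -> graded_ring G) (T : J' -> graded_ring G) (pi : J -> J') :
  bijective pi -> (forall j, gr_isomorphic (R j) (T (pi j))) ->
  gr_isomorphic (gprod R) (gprod T).
Proof.
move=> pib iso; pose isoP j := cid ((gr_isomorphicP _ _).1 (iso j)).
pose f j := projT1 (isoP j); pose h j := projT1 (cid (projT2 (isoP j))).
have fhP j : [/\ cancel (f j) (h j), cancel (h j) (f j),
                 graded_hom (f j) & graded_hom (h j)].
  exact: projT2 (cid (projT2 (isoP j))).
pose phi (y : fullprod (fun k => gr_zmod (T k))) :
  fullprod (fun j => gr_zmod (R j)) := fun j => h j (y (pi j)).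
have [psi psiE] : {psi : fullprod (fun j => gr_zmod (R j)) ->
    fullprod (fun k => gr_zmod (T k)) & forall z j, psi z (pi j) = f j (z j)}.
  exact: choice (fun z => reindex_family pib (fun j => f j (z j))).
(* Maps into the T k are compared at the indices [pi j] only, where [psiE]
   applies. *)
have pi_ind (P : J' -> Prop) : (forall j, P (pi j)) -> forall k, P k.
  by have [s _ sK] := pib => Ppi k; rewrite -(sK k).
have phiD : {morph phi : x y / x + y}.
  by move=> x y; apply: fullprodP => j; have [_ _ _ [hD _ _]] := fhP j; exact: hD.
have phig g y : prod_comp (R := T) g y -> prod_comp (R := R) g (phi y).
  by move=> yg j; have [_ _ _ [_ _ hg]] := fhP j; exact/hg/yg.
have psiD : {morph psi : x y / x + y}.
  move=> x y; apply: fullprodP; apply: pi_ind => j.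
  have [_ _ [fD _ _] _] := fhP j.
  by rewrite psiE [LHS]fD -!psiE.
have psig g x : prod_comp (R := R) g x -> prod_comp (R := T) g (psi x).
  move=> xg; apply: pi_ind => j; rewrite psiE.
  by have [_ _ [_ _ fg] _] := fhP j; exact/fg/xg.
have phi_gprod := gprod_pred_additive phiD phig.
have psi_gprod := gprod_pred_additive psiD psig.
exists (fun x : gprod R => GProd (psi_gprod _ (gprod_valP x))); split.
- exists (fun y : gprod T => GProd (phi_gprod _ (gprod_valP y))) => x.
    apply: gprod_eqP => j; have [fK _ _ _] := fhP j.
    by rewrite /= /phi psiE fK.
  apply: gprod_eqP; apply: pi_ind => j; have [_ hK _ _] := fhP j.
  by rewrite /= psiE hK.
- by move=> x y; apply: val_inj; exact: psiD.
- move=> x y; apply: gprod_eqP; apply: pi_ind => j.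
  have [_ _ [_ fM _] _] := fhP j.
  by rewrite /= /prod_mul !psiE fM.
- by move=> g x; exact: psig.
Qed.

Theorem theorem5p43 (G : groupoid) (J J' : Type)
    (R : J -> graded_ring G) (T : J' -> graded_ring G)
    (sumR : summable R) (sumT : summable T)
    (simpleR : forall j, gr_simple (R j)) (simpleT : forall j, gr_simple (T j)) :
  gr_isomorphic (gprod R) (gprod T) <->
  exists pi : J -> J', bijective pi /\ forall j, gr_isomorphic (R j) (T (pi j)).
Proof.
split=> [/gr_isomorphicP[F [F' [FK F'K Fh F'h]]]|[pi [pib iso]]]; last first.
  exact: gprod_isomorphic iso.
have [FD _ _] := Fh; have [F'D _ _] := F'h.
have [pi piF] := choice (fun j => matched_total FK F'K Fh (simpleR j)).
have [s sF'] := choice (fun k => matched_total F'K FK F'h (simpleT k)).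
exists pi; split=> [|j]; last exact: matched_isomorphic (piF j).
exists s => [j|k].
  exact: (matched_functional F'K F'h (simpleT _) (sF' _) (matched_sym FK FD (piF j))).
exact: (matched_functional FK Fh (simpleR _) (piF _) (matched_sym F'K F'D (sF' k))).
Qed.
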